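(* Let $K\subseteq G$ be a closed inclusion of affine algebraic groups over $\Bbbk$. Then the action of $K$ on $G$ by translations is linearly reductive and the action of $G$ by translations on $G/K$ is linearly reductive if and only if $K$ is linearly reductive.
   Context: $\Bbbk$ is an algebraically closed field; all algebras are commutative. For an affine algebraic group $G$ and a rational $G$-module algebra $R$ (commutative $\Bbbk$-algebra and rational $G$-module with $G$ acting by algebra automorphisms), a $(G,R)$-module is a rational $G$-module $M$ that is also an $R$-module with $x\cdot(rm) = (x\cdot r)(x\cdot m)$; morphisms are $G$-equivariant $R$-linear maps; ${}^G M$ is the set of $G$-fixed elements. The action of $G$ on $R$ is linearly reductive if for every $(G,R)$-module $M$, every $G$-stable ideal $J\subseteq R$ and every surjective morphism of $(G,R)$-modules $\lambda: M\to R/J$, there exists $m\in {}^G M$ with $\lambda(m)=1+J$. The action of $G$ on an affine variety $X$ is linearly reductive if the induced action of $G$ on $\Bbbk[X]$ is. The action of $K$ on $G$ is by right translation, $(g,k)\mapsto gk$, so $K$ acts on $\Bbbk[G]$ by $(k\cdot f)(g)=f(gk)$. The action of $G$ on $G/K$ is by left translation (so $h\in G$ acts on functions by $f\mapsto f(h^{-1}\,\cdot\,)$); linear reductivity of this action is considered for $G/K$ an affine variety with $\Bbbk[G/K]={}^K\Bbbk[G]$ (linear reductivity of the action of $K$ on $G$ is equivalent to $G/K$ being affine). An affine algebraic group $K$ is linearly reductive if every surjective morphism $M\to N$ of rational $K$-modules restricts to a surjection ${}^K M\to {}^K N$ (equivalently, every rational $K$-module is completely reducible). *)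

(* Defs.v *)
From HB Require Import structures.
From mathcomp Require Import all_boot all_algebra.
From mathcomp Require Import boolp.

Set Implicit Arguments.
Unset Strict Implicit.
Unset Printing Implicit Defensive.

Import GRing.Theory.
Local Open Scope ring_scope.

(* An affine variety with set of points X is a finitely generated algebra k[X]
   of functions X -> k such that every algebra morphism k[X] -> k is evaluation
   at exactly one point.  Elements of k[X] are identified with functions through
   [evalf] and [evalf_inj]; in particular k[X] is reduced. *)
Record affine_structure (k : closedFieldType) (X : Type) := AffineStructure {
  coord_ring : comAlgType k;
  evalf : X -> {lrmorphism coord_ring -> k | *%R};
  evalf_inj : forall f h : coord_ring,
    (forall x, evalf x f = evalf x h) -> f = h;
  coord_fg : exists s : seq coord_ring,
    forall S : subalgClosed coord_ring,
      {subset s <= S} -> forall f : coord_ring, f \in S;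
  evalf_bij : forall phi : {lrmorphism coord_ring -> k | *%R},
    exists! x : X, forall f, phi f = evalf x f
}.

(* [mul_regular] says that multiplication is a morphism G x G -> G: regular
   functions on G x G are the elements of k[G] (x) k[G], that is, the finite sums
   of products a(x) b(y). *)
Record affine_group (k : closedFieldType) := AffineGroup {
  ag_group :> groupType;
  ag_affine : affine_structure k ag_group;
  mul_regular : forall f : coord_ring ag_affine,
    exists n (a b : 'I_n -> coord_ring ag_affine), forall x y : ag_group,
      evalf ag_affine (x * y)%g f =
        \sum_i evalf ag_affine x (a i) * evalf ag_affine y (b i);
  inv_regular : forall f : coord_ring ag_affine,
    exists h : coord_ring ag_affine, forall x : ag_group,
      evalf ag_affine (x^-1)%g f = evalf ag_affine x h
}.

Definition regfun (k : closedFieldType) (G : affine_group k) : comAlgType k :=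
  coord_ring (ag_affine G).

Definition evalg (k : closedFieldType) (G : affine_group k) (x : G)
    (f : regfun G) : k :=
  evalf (ag_affine G) x f.

(* A closed inclusion of K in G: an injective group morphism with Zariski closed
   image, where k[K] consists of the restrictions of the elements of k[G]. *)
Record closed_inclusion (k : closedFieldType) (K G : affine_group k) :=
  ClosedInclusion {
  incl :> K -> G;
  inclM : {morph incl : x y / (x * y)%g};
  incl_inj : injective incl;
  incl_closed : exists S : regfun G -> Prop,
    forall g : G, (exists x, incl x = g) <-> (forall f, S f -> evalg g f = 0);
  incl_restr : forall f : regfun G,
    exists h : regfun K, forall x, evalg x h = evalg (incl x) f;
  incl_ext : forall h : regfun K,
    exists f : regfun G, forall x, evalg x h = evalg (incl x) f
}.

Section RationalModules.

Variables (k : closedFieldType) (G : affine_group k).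

(* Every vector lies in a finite-dimensional G-stable subspace (with basis e) on
   which G acts by a morphism of algebraic groups G -> GL (with matrix A). *)
Definition locally_rational (M : lmodType k) (act : G -> M -> M) : Prop :=
  forall m : M, exists n (e : 'I_n -> M) (A : 'I_n -> 'I_n -> regfun G),
    [/\ forall c : 'I_n -> k, \sum_i c i *: e i = 0 -> forall i, c i = 0,
        exists c : 'I_n -> k, m = \sum_i c i *: e i
      & forall g j, act g (e j) = \sum_i evalg g (A i j) *: e i].

Record rational_action (M : lmodType k) (act : G -> M -> M) : Prop :=
  RationalAction {
  act_linear : forall g, linear (act g);
  act1 : forall m, act 1%g m = m;
  actM : forall g h m, act (g * h)%g m = act g (act h m);
  act_rational : locally_rational act
}.

Record rat_module := RatModule {
  rm_car :> lmodType k;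
  rm_act : G -> rm_car -> rm_car;
  rm_actP : rational_action rm_act
}.

Record rat_algebra := RatAlgebra {
  ra_car :> comAlgType k;
  ra_act : G -> ra_car -> ra_car;
  ra_actP : rational_action ra_act;
  ra_act_one : forall g, ra_act g 1 = 1;
  ra_act_mul : forall g, {morph ra_act g : r s / r * s}
}.

Definition fixed (M : lmodType k) (act : G -> M -> M) (m : M) : Prop :=
  forall g, act g m = m.

Definition surj (A B : Type) (f : A -> B) : Prop := forall b, exists a, f a = b.

Definition linearly_reductive : Prop :=
  forall (M N : rat_module) (f : M -> N),
    linear f ->
    (forall x m, f (rm_act x m) = rm_act x (f m)) ->
    surj f ->
    forall n, fixed (@rm_act N) n -> exists2 m, fixed (@rm_act M) m & f m = n.

(* The R-module structure [gr_scale] is required to induce the given k-vector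
   space structure, through its linearity in the first argument. *)
Record gr_module (R : rat_algebra) := GRModule {
  gr_car :> lmodType k;
  gr_act : G -> gr_car -> gr_car;
  gr_scale : R -> gr_car -> gr_car;
  gr_actP : rational_action gr_act;
  gr_scale_linearl : forall m, linear (gr_scale ^~ m);
  gr_scale_linearr : forall r, linear (gr_scale r);
  gr_scale1 : forall m, gr_scale 1 m = m;
  gr_scaleM : forall r s m, gr_scale (r * s) m = gr_scale r (gr_scale s m);
  gr_act_scale : forall x r m,
    gr_act x (gr_scale r m) = gr_scale (ra_act x r) (gr_act x m)
}.

Definition gr_morphism (R : rat_algebra) (M N : gr_module R) (f : M -> N) : Prop :=
  [/\ linear f,
      forall r m, f (gr_scale r m) = gr_scale r (f m)
    & forall x m, f (gr_act x m) = gr_act x (f m)].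

Record stable_ideal (R : rat_algebra) := StableIdeal {
  si_pred :> zmodClosed R;
  si_mul : forall r a : R, a \in si_pred -> r * a \in si_pred;
  si_act : forall (x : G) (a : R), a \in si_pred -> ra_act x a \in si_pred
}.

End RationalModules.

Section Rationality.

Variables (k : closedFieldType) (G : affine_group k).

Lemma evalg_inj (f h : regfun G) : (forall x, evalg x f = evalg x h) -> f = h.
Proof. exact: evalf_inj. Qed.

Lemma evalg_sum (x : G) n (c : 'I_n -> k) (f : 'I_n -> regfun G) :
  evalg x (\sum_i c i *: f i) = \sum_i c i * evalg x (f i).
Proof.
by rewrite /evalg linear_sum; apply: eq_bigr => i _; rewrite linearZ.
Qed.

Lemma rtransl_ex (y : G) (f : regfun G) :
  exists h : regfun G, forall x, evalg x h = evalg (x * y)%g f.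
Proof.
have [n [a [b ab]]] := mul_regular f.
exists (\sum_i evalg y (b i) *: a i) => x.
by rewrite evalg_sum [RHS]ab; apply: eq_bigr => i _; rewrite mulrC.
Qed.

Lemma ltransl_ex (y : G) (f : regfun G) :
  exists h : regfun G, forall x, evalg x h = evalg (y^-1 * x)%g f.
Proof.
have [n [a [b ab]]] := mul_regular f.
exists (\sum_i evalg (y^-1)%g (a i) *: b i) => x.
by rewrite evalg_sum [RHS]ab.
Qed.

(* (y . f)(x) = f (x y) *)
Definition rtransl (y : G) (f : regfun G) : regfun G :=
  projT1 (cid (rtransl_ex y f)).

(* (y . f)(x) = f (y^-1 x) *)
Definition ltransl (y : G) (f : regfun G) : regfun G :=
  projT1 (cid (ltransl_ex y f)).

Lemma rtranslE y f x : evalg x (rtransl y f) = evalg (x * y)%g f.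
Proof. by rewrite /rtransl; case: cid. Qed.

Lemma ltranslE y f x : evalg x (ltransl y f) = evalg (y^-1 * x)%g f.
Proof. by rewrite /ltransl; case: cid. Qed.

Variables (M : lmodType k) (act : G -> M -> M).

Lemma coaction_free (m : M) :
  (exists n (b : 'I_n -> regfun G) (e : 'I_n -> M),
     forall g, act g m = \sum_i evalg g (b i) *: e i) ->
  exists n (b : 'I_n -> regfun G) (e : 'I_n -> M),
    (forall c : 'I_n -> k, \sum_i c i *: e i = 0 -> forall i, c i = 0) /\
    forall g, act g m = \sum_i evalg g (b i) *: e i.
Proof.
case=> n; elim: n => [|n IHn] [b [e be]].
  by exists 0%N, b, e; split=> // c _ [].
have [fe|] := pselect (forall c : 'I_n.+1 -> k,
    \sum_i c i *: e i = 0 -> forall i, c i = 0); first by exists n.+1, b, e.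
move=> /existsNP[c /not_implyP[ce0 /existsNP[i0 /eqP ci0]]].
apply: IHn.
exists (fun j => b (lift i0 j) - (c i0)^-1 *: (c (lift i0 j) *: b i0)).
exists (fun j => e (lift i0 j)) => g.
have ei0 : e i0 = - ((c i0)^-1 *: \sum_j c (lift i0 j) *: e (lift i0 j)).
  move: ce0; rewrite (bigD1_ord i0) //= => /eqP; rewrite addr_eq0 => /eqP E.
  by rewrite -scalerN -E scalerA mulVf // scale1r.
rewrite be (bigD1_ord i0) //= {1}ei0 scalerN addrC scaler_sumr scaler_sumr.
rewrite -sumrB; apply: eq_bigr => j _.
rewrite /evalg raddfB /= scalerBl !linearZ /= !scalerA; congr (_ + _ *: _).
by rewrite -mulrA mulrC -mulrA.
Qed.

Hypothesis act1 : forall m, act 1%g m = m.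
Hypothesis actM : forall g h m, act (g * h)%g m = act g (act h m).
Hypothesis actL : forall g, linear (act g).

(* If g . m = sum_i b_i(g) e_i with b_i regular, then m lies in a
   finite-dimensional rational subspace spanned by elements of its orbit. *)
Lemma coaction_orbit (m : M) :
  (exists n (b : 'I_n -> regfun G) (e : 'I_n -> M),
     forall g, act g m = \sum_i evalg g (b i) *: e i) ->
  exists n (p : 'I_n -> G) (A : 'I_n -> regfun G),
    (forall c : 'I_n -> k, \sum_i c i *: act (p i) m = 0 -> forall i, c i = 0) /\
    forall g, act g m = \sum_i evalg g (A i) *: act (p i) m.
Proof.
move=> /coaction_free[n [b [e [fe be]]]].
pose B r (p : 'I_r -> G) := \matrix_(j < r, i < n) evalg (p j) (b i).
have Be r (p : 'I_r -> G) j : act (p j) m = \sum_i B r p j i *: e i.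
  by rewrite be; apply: eq_bigr => i _; rewrite mxE.
have [r [p [fp maxp]]] : exists r (p : 'I_r -> G), row_free (B r p) /\
    forall g, (\row_i evalg g (b i) <= B r p)%MS.
  pose P r := exists p : 'I_r -> G, row_free (B r p).
  have P0 : exists r, `[< P r >].
    exists 0%N; apply/asboolP; exists (fun _ => 1%g).
    by rewrite /row_free -leqn0 rank_leq_row.
  have Pn r : `[< P r >] -> (r <= n)%N.
    by move=> /asboolP[p] /eqP <-; apply: rank_leq_col.
  case: (ex_maxnP P0 Pn) => r /asboolP[p fp] maxr.
  exists r, p; split=> // g; apply: contraT => ng.
  have: `[< P (1 + r)%N >].
    apply/asboolP.
    exists (fun j => match split j with inl _ => g | inr j' => p j' end).
    have -> : B (1 + r)%N (fun j => match split j with inl _ => g | inr j' => p j' end)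
            = col_mx (\row_i evalg g (b i)) (B r p).
      apply/matrixP => j i; rewrite !mxE; case: (split j) => j'; by rewrite !mxE.
    rewrite -kermx_eq0; apply/eqP/row_matrixP => l; rewrite row0.
    set u := row l _.
    have u0 : u *m col_mx (\row_i evalg g (b i)) (B r p) = 0.
      by apply/sub_kermxP; rewrite row_sub.
    move: u0; rewrite -[u](@hsubmxK _ 1 1 r) mul_row_col.
    set x := lsubmx _; set y := rsubmx _ => /eqP.
    rewrite addr_eq0 => /eqP xy.
    have x0 : x = 0.
      apply: contraNeq ng => xn0.
      have x00 : x 0 0 != 0.
        apply: contraNneq xn0 => x00; apply/eqP/matrixP => ? ?.
        by rewrite [RHS]mxE !ord1 x00.
      have E : x 0 0 *: (\row_i evalg g (b i)) = - (y *m B r p).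
        by rewrite -xy [x in RHS]mx11_scalar mul_scalar_mx.
      rewrite -[X in (X <= _)%MS](scalerK x00) E.
      by rewrite scalemx_sub // -mulNmx submxMl.
    move: xy; rewrite x0 mul0mx => /esym/eqP; rewrite oppr_eq0 => /eqP yB.
    have -> : y = 0 by apply: (row_free_inj fp); rewrite yB mul0mx.
    by rewrite row_mx0.
  by move=> /maxr; rewrite ltnn.
exists r, p, (fun j => \sum_i pinvmx (B r p) i j *: b i); split.
  move=> c ce0 j.
  have: (\row_j c j) *m B r p = 0.
    apply/matrixP => i0 i; rewrite !ord1 mxE.
    transitivity (\sum_j0 c j0 * B r p j0 i).
      by apply: eq_bigr => j0 _; rewrite mxE.
    rewrite mxE; apply: (fe (fun i => \sum_j0 c j0 * B r p j0 i)).
    rewrite -[RHS]ce0; under eq_bigr do rewrite scaler_suml.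
    rewrite exchange_big /=; apply: eq_bigr => j0 _.
    by rewrite Be scaler_sumr; apply: eq_bigr => i1 _; rewrite scalerA.
  rewrite -[X in _ = X](mul0mx _ (B r p)) => /(row_free_inj fp)/matrixP/(_ 0 j).
  by rewrite !mxE.
move=> g; rewrite be.
pose a := (\row_i evalg g (b i)) *m pinvmx (B r p).
have aB : a *m B r p = \row_i evalg g (b i) by rewrite mulmxKpV.
transitivity (\sum_j a 0 j *: act (p j) m); last first.
  apply: eq_bigr => j _; rewrite evalg_sum mxE; congr (_ *: _).
  by apply: eq_bigr => i _; rewrite mxE mulrC.
under [RHS]eq_bigr => j _ do rewrite Be scaler_sumr.
rewrite exchange_big /=; apply: eq_bigr => i _.
have := congr1 (fun X : 'rV_n => X 0 i) aB; rewrite !mxE => <-.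
by rewrite scaler_suml; apply: eq_bigr => j _; rewrite scalerA.
Qed.

Lemma coaction_rational :
  (forall m : M, exists n (b : 'I_n -> regfun G) (e : 'I_n -> M),
     forall g, act g m = \sum_i evalg g (b i) *: e i) ->
  rational_action act.
Proof.
move=> co; split=> // m.
have [n [p [A [fp pA]]]] := coaction_orbit (co m).
exists n, (fun j => act (p j) m), (fun i j => rtransl (p j) (A i)); split=> //.
  by exists (fun i => evalg 1%g (A i)); rewrite -pA act1.
move=> g j; rewrite -actM pA.
by apply: eq_bigr => i _; rewrite rtranslE.
Qed.

Lemma rational_coaction : locally_rational act ->
  forall m : M, exists n (b : 'I_n -> regfun G) (e : 'I_n -> M),
     forall g, act g m = \sum_i evalg g (b i) *: e i.
Proof.
move=> rat m; have [n [e [A [_ [c ->] Ae]]]] := rat m.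
exists n, (fun i => \sum_j c j *: A i j), e => g.
have act_sum : act g (\sum_j c j *: e j) = \sum_j c j *: act g (e j).
  pose h := GRing.isLinear.Build _ _ _ _ (act g) (actL g).
  pose L : {linear M -> M} := HB.pack (act g) h.
  by rewrite -[act g]/(L : M -> M) linear_sum; apply: eq_bigr => j _; rewrite linearZ.
rewrite act_sum; under eq_bigr => j _ do rewrite Ae scaler_sumr.
rewrite exchange_big /=; apply: eq_bigr => i _.
by rewrite evalg_sum scaler_suml; apply: eq_bigr => j _; rewrite scalerA.
Qed.

End Rationality.

Section QuotientModule.

Variables (k : closedFieldType) (G : affine_group k) (R : rat_algebra G).
Variable J : stable_ideal R.

Definition quot_car := {ideal_quot J}.
HB.instance Definition _ := GRing.Zmodule.copy quot_car {ideal_quot J}.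

Definition qpi (r : R) : quot_car := (\pi_({ideal_quot J}) r)%qT.

Lemma qpi_eq (r s : R) : (qpi r = qpi s) <-> (r - s \in J).
Proof. by rewrite Quotient.idealrBE; split=> [/eqP|/eqP]. Qed.

Lemma qpiD (r s : R) : qpi (r + s) = qpi r + qpi s.
Proof. by rewrite /qpi !piE. Qed.

Lemma qpi_repr (x : quot_car) : qpi (repr x) = x.
Proof. exact: reprK. Qed.

Lemma qpi_ind (P : quot_car -> Prop) : (forall r, P (qpi r)) -> forall x, P x.
Proof. by move=> Pr x; rewrite -(qpi_repr x). Qed.

Definition quot_kscale (c : k) (x : quot_car) : quot_car := qpi (c *: repr x).
Definition quot_scale (r : R) (x : quot_car) : quot_car := qpi (r * repr x).
Definition quot_act (g : G) (x : quot_car) : quot_car := qpi (ra_act g (repr x)).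

Lemma repr_qpi r : repr (qpi r) - r \in J.
Proof. by apply/qpi_eq; rewrite qpi_repr. Qed.

Lemma quot_kscaleE c r : quot_kscale c (qpi r) = qpi (c *: r).
Proof.
apply/qpi_eq; rewrite -scalerBr -[_ - _ in X in X \in _]mul1r scalerAl.
exact/si_mul/repr_qpi.
Qed.

Lemma quot_scaleE s r : quot_scale s (qpi r) = qpi (s * r).
Proof. by apply/qpi_eq; rewrite -mulrBr; apply/si_mul/repr_qpi. Qed.

Lemma ra_actB g (r s : R) : ra_act g (r - s) = ra_act g r - ra_act g s.
Proof.
by rewrite addrC -scaleN1r (act_linear (ra_actP R)) scaleN1r addrC.
Qed.

Lemma quot_actE g r : quot_act g (qpi r) = qpi (ra_act g r).
Proof. by apply/qpi_eq; rewrite -ra_actB; apply/si_act/repr_qpi. Qed.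

Lemma quot_kscaleA c d x : quot_kscale c (quot_kscale d x) = quot_kscale (c * d) x.
Proof. by elim/qpi_ind: x => r; rewrite !quot_kscaleE scalerA. Qed.
Lemma quot_kscale1 : left_id 1 quot_kscale.
Proof. by elim/qpi_ind => r; rewrite quot_kscaleE scale1r. Qed.
Lemma quot_kscaleDr : right_distributive quot_kscale +%R.
Proof.
move=> c; elim/qpi_ind => r; elim/qpi_ind => s.
by rewrite -qpiD !quot_kscaleE -qpiD scalerDr.
Qed.
Lemma quot_kscaleDl x : {morph quot_kscale^~ x : c d / c + d}.
Proof.
by move=> c d; elim/qpi_ind: x => r; rewrite !quot_kscaleE -qpiD scalerDl.
Qed.
HB.instance Definition _ := GRing.Zmodule_isLmodule.Build k quot_car
  quot_kscaleA quot_kscale1 quot_kscaleDr quot_kscaleDl.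

Lemma qpiZ c r : qpi (c *: r) = c *: qpi r.
Proof. by rewrite -quot_kscaleE. Qed.

Lemma qpi0 : qpi 0 = 0.
Proof. by rewrite -[0 in LHS](scale0r 0) qpiZ scale0r. Qed.

Lemma qpi_sum n (F : 'I_n -> R) : qpi (\sum_i F i) = \sum_i qpi (F i).
Proof. exact: (big_morph _ qpiD qpi0). Qed.

Lemma quot_act_rational : rational_action quot_act.
Proof.
have RP := ra_actP R.
apply: coaction_rational.
- by elim/qpi_ind => r; rewrite quot_actE (act1 RP).
- by move=> g h; elim/qpi_ind => r; rewrite !quot_actE (actM RP).
- move=> g c; elim/qpi_ind => r; elim/qpi_ind => s.
  by rewrite -qpiZ -qpiD !quot_actE (act_linear RP) qpiD qpiZ.
elim/qpi_ind => r.
have [n [b [e be]]] := rational_coaction (act_linear RP) (act_rational RP) r.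
exists n, b, (fun i => qpi (e i)) => g; rewrite quot_actE be qpi_sum.
by apply: eq_bigr => i _; rewrite qpiZ.
Qed.

Lemma quot_scale_linearl x : linear (quot_scale ^~ x).
Proof.
move=> c r s; elim/qpi_ind: x => u.
by rewrite !quot_scaleE -qpiZ -qpiD mulrDl scalerAl.
Qed.
Lemma quot_scale_linearr r : linear (quot_scale r).
Proof.
move=> c; elim/qpi_ind => u; elim/qpi_ind => v.
by rewrite -qpiZ -qpiD !quot_scaleE -qpiZ -qpiD mulrDr scalerAr.
Qed.
Lemma quot_scale1 x : quot_scale 1 x = x.
Proof. by elim/qpi_ind: x => u; rewrite quot_scaleE mul1r. Qed.
Lemma quot_scaleM r s x : quot_scale (r * s) x = quot_scale r (quot_scale s x).
Proof. by elim/qpi_ind: x => u; rewrite !quot_scaleE mulrA. Qed.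
Lemma quot_act_scale g r x :
  quot_act g (quot_scale r x) = quot_scale (ra_act g r) (quot_act g x).
Proof.
by elim/qpi_ind: x => u; rewrite !(quot_scaleE, quot_actE) ra_act_mul.
Qed.

(* The (G, R)-module R / J; [qpi r] is the class r + J. *)
Definition quot_module : gr_module R :=
  GRModule quot_act_rational quot_scale_linearl quot_scale_linearr
    quot_scale1 quot_scaleM quot_act_scale.

End QuotientModule.

Definition linearly_reductive_action (k : closedFieldType) (G : affine_group k)
    (R : rat_algebra G) : Prop :=
  forall (M : gr_module R) (J : stable_ideal R) (f : M -> quot_module J),
    gr_morphism f -> surj f ->
    exists2 m : M, fixed (@gr_act _ _ _ M) m & f m = qpi J 1.

Section Translations.

Variables (k : closedFieldType) (K G : affine_group k) (i : closed_inclusion K G).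

Lemma evalg_linear (x : G) c (f h : regfun G) :
  evalg x (c *: f + h) = c * evalg x f + evalg x h.
Proof. by rewrite /evalg linearP. Qed.

Lemma evalgM (x : G) (f h : regfun G) : evalg x (f * h) = evalg x f * evalg x h.
Proof. by rewrite /evalg rmorphM. Qed.

Lemma evalg1 (x : G) : evalg x 1 = 1 :> k.
Proof. by rewrite /evalg rmorph1. Qed.

Lemma incl1 : i 1%g = 1%g.
Proof.
by apply: (@mulgI _ (i 1%g)); rewrite -inclM !mulg1.
Qed.

Definition rtransl_incl (x : K) (f : regfun G) : regfun G := rtransl (i x) f.

Lemma rtransl_rational : rational_action rtransl_incl.
Proof.
apply: coaction_rational.
- by move=> f; apply: evalg_inj => x; rewrite rtranslE incl1 mulg1.
- by move=> g h f; apply: evalg_inj => x; rewrite !rtranslE inclM mulgA.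
- by move=> g c f h; apply: evalg_inj => x; rewrite !(evalg_linear, rtranslE).
move=> f; have [n [a [b ab]]] := mul_regular f.
exists n, (fun j => projT1 (cid (incl_restr i (b j)))), a => g.
apply: evalg_inj => x; rewrite rtranslE evalg_sum [LHS]ab.
by apply: eq_bigr => j _; case: cid => h /= ->; rewrite mulrC.
Qed.

Lemma rtransl_incl1 x : rtransl_incl x 1 = 1.
Proof. by apply: evalg_inj => y; rewrite rtranslE !evalg1. Qed.

Lemma rtransl_inclM x : {morph rtransl_incl x : f h / f * h}.
Proof. by move=> f h; apply: evalg_inj => y; rewrite !(rtranslE, evalgM). Qed.

(* k[G] with the action of K induced by right translations of K on G *)
Definition right_translation_algebra : rat_algebra K :=
  RatAlgebra rtransl_rational rtransl_incl1 rtransl_inclM.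

Definition invariant : {pred regfun G} :=
  fun f => `[< fixed rtransl_incl f >].

Lemma invariantP (f : regfun G) : reflect (fixed rtransl_incl f) (f \in invariant).
Proof. exact: asboolP. Qed.

Lemma invariant_subalg : GRing.subsemialg_closed invariant.
Proof.
have L := act_linear rtransl_rational.
split=> [||c f /invariantP f_inv|f h /invariantP f_inv /invariantP h_inv].
- by apply/invariantP; exact: rtransl_incl1.
- split=> [|f h /invariantP f_inv /invariantP h_inv].
    apply/invariantP => x; have := L x (-1) 0 0.
    by rewrite scaler0 add0r scaleN1r addNr.
  by apply/invariantP => x; have := L x 1 f h; rewrite !scale1r f_inv h_inv.
- apply/invariantP => x; apply: evalg_inj => y.
  have := congr1 (evalg y) (f_inv x); rewrite !rtranslE /evalg !linearZ /=.
  by move=> ->.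
- by apply/invariantP => x; rewrite rtransl_inclM f_inv h_inv.
Qed.
HB.instance Definition _ :=
  GRing.isSubalgClosed.Build k (regfun G) invariant
   invariant_subalg.

(* ^K k[G] *)
Record invfun := InvFun { inv_val :> regfun G; _ : inv_val \in invariant }.
HB.instance Definition _ := [isSub for inv_val].
HB.instance Definition _ := [Choice of invfun by <:].
HB.instance Definition _ := [SubChoice_isSubAlgebra of invfun by <:].
HB.instance Definition _ := [SubNzRing_isSubComNzRing of invfun by <:].

Lemma ltransl1 (f : regfun G) : ltransl 1%g f = f.
Proof. by apply: evalg_inj => x; rewrite ltranslE invg1 mul1g. Qed.

Lemma ltranslM (g h : G) (f : regfun G) :
  ltransl (g * h)%g f = ltransl g (ltransl h f).
Proof. by apply: evalg_inj => x; rewrite !ltranslE invgM mulgA. Qed.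

Lemma ltransl_linear (g : G) : linear (@ltransl k G g).
Proof.
by move=> c f h; apply: evalg_inj => x; rewrite !(evalg_linear, ltranslE).
Qed.

Lemma ltransl_coaction (f : regfun G) :
  exists n (b : 'I_n -> regfun G) (e : 'I_n -> regfun G),
    forall g, ltransl g f = \sum_i evalg g (b i) *: e i.
Proof.
have [n [a [b ab]]] := mul_regular f.
exists n, (fun j => projT1 (cid (inv_regular (a j)))), b => g.
apply: evalg_inj => x; rewrite ltranslE evalg_sum [LHS]ab.
by apply: eq_bigr => j _; case: cid => h /= hE; rewrite hE.
Qed.

Lemma ltransl_invariant (g : G) (f : invfun) :
  ltransl g (f : regfun G) \in invariant.
Proof.
case: f => f /= /invariantP f_inv; apply/invariantP => x; apply: evalg_inj => y.
have := congr1 (evalg (g^-1 * y)%g) (f_inv x).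
by rewrite /rtransl_incl !(rtranslE, ltranslE) mulgA.
Qed.

Definition ltransl_invfun (g : G) (f : invfun) : invfun :=
  InvFun (ltransl_invariant g f).

Lemma invfun_sum n (c : 'I_n -> k) (f : 'I_n -> invfun) :
  inv_val (\sum_j c j *: f j) = \sum_j c j *: inv_val (f j).
Proof.
rewrite -[inv_val _]/(val _) raddf_sum.
by apply: eq_bigr => j _; rewrite -[LHS]/(val _) linearZ.
Qed.

Lemma ltransl_invfun_rational : rational_action ltransl_invfun.
Proof.
apply: coaction_rational.
- by move=> f; apply: val_inj; exact: ltransl1.
- by move=> g h f; apply: val_inj; exact: ltranslM.
- by move=> g c f h; apply: val_inj; exact: ltransl_linear.
move=> f; have [n [p [A [_ pA]]]] := coaction_orbit (ltransl_coaction f).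
exists n, A, (fun j => ltransl_invfun (p j) f) => g; apply: val_inj.
by rewrite /= invfun_sum -pA.
Qed.

Lemma ltransl_invfun1 g : ltransl_invfun g 1 = 1.
Proof.
by apply/val_inj/evalg_inj => x /=; rewrite ltranslE !evalg1.
Qed.

Lemma ltransl_invfunM g : {morph ltransl_invfun g : f h / f * h}.
Proof.
by move=> f h; apply/val_inj/evalg_inj => x /=; rewrite !(ltranslE, evalgM).
Qed.

(* k[G / K] = ^K k[G] with the action of G induced by left translations *)
Definition homogeneous_algebra : rat_algebra G :=
  RatAlgebra ltransl_invfun_rational ltransl_invfun1 ltransl_invfunM.

End Translations.

(* Main.v *)
(* From right to left, only the action on G/K needs an argument.  Given
   f : M -> k[G/K]/J, reductivity of K yields a K-fixed m0 with f(m0) = 1 + J.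
   Write g.m0 = sum_j A_j(g) e_j with the e_j linearly independent in the orbit
   of m0; the A_j are right K-invariant because m0 is K-fixed.  Then
   sum_j A_j e_j is G-fixed, and it maps to (sum_j A_j) + J = 1 + J since every
   e_j maps to 1 + J.
   From left to right, let f : M -> N be a surjection of K-modules and n != 0 a
   fixed vector of N, f(m0) = n.  The span W of the orbit of m0 maps onto k n.
   The first hypothesis, applied to k[G] (x) W -> k[G], gives a K-fixed element
   over 1, so that the (G, k[G/K])-module (k[G] (x) W)^K maps onto k[G/K]; the
   second one then gives a G-fixed element of it over 1, which is constant,
   hence a K-fixed vector of W over n. *)

Require Import Defs.
From HB Require Import structures.
From mathcomp Require Import all_boot all_algebra.
From mathcomp Require Import boolp.

Set Implicit Arguments.
Unset Strict Implicit.
Unset Printing Implicit Defensive.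

Import GRing.Theory.
Local Open Scope ring_scope.

(** * Bare linear functions and coordinates in free families *)

Section LinearMaps.

Variables (k : pzRingType) (M N : lmodType k) (f : M -> N).
Hypothesis fL : linear f.

(** Actions and morphisms are plain functions with a separate proof of linearity; bundling them
    gives access to the general facts on linear maps. *)
Lemma linear_map_pack : exists L : {linear M -> N}, f = L.
Proof.
pose h := GRing.isLinear.Build _ _ _ _ f fL.
by exists (HB.pack f h : {linear M -> N}).
Qed.

Lemma linear_map0 : f 0 = 0.
Proof. by have [L ->] := linear_map_pack; rewrite raddf0. Qed.

Lemma linear_mapZ c m : f (c *: m) = c *: f m.
Proof. by have [L ->] := linear_map_pack; rewrite linearZ. Qed.

Lemma linear_map_sum (I : finType) (e : I -> M) :
  f (\sum_i e i) = \sum_i f (e i).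
Proof. by have [L ->] := linear_map_pack; rewrite linear_sum. Qed.

Lemma linear_combination (I : finType) (c : I -> k) (e : I -> M) :
  f (\sum_i c i *: e i) = \sum_i c i *: f (e i).
Proof. by rewrite linear_map_sum; under eq_bigr do rewrite linear_mapZ. Qed.

End LinearMaps.

Lemma free_coef (k : pzRingType) (M : lmodType k) (n : nat) (e : 'I_n -> M) :
  (forall c : 'I_n -> k, \sum_i c i *: e i = 0 -> forall i, c i = 0) ->
  forall c d : 'I_n -> k,
    \sum_i c i *: e i = \sum_i d i *: e i -> forall i, c i = d i.
Proof.
move=> e_free c d cd i; apply/eqP; rewrite -subr_eq0; apply/eqP.
apply: (e_free (fun i => c i - d i)); under eq_bigr do rewrite scalerBl.
by rewrite sumrB cd subrr.
Qed.

(** * Closure properties of regular maps from the group to a vector space *)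

Section RegularMaps.

Variables (k : closedFieldType) (G : affine_group k).
Implicit Types M N : lmodType k.

(** The elements of k[G] (x) M seen as functions; for orbit maps this is the hypothesis of
    [coaction_rational]. *)
Definition regular_map M (F : G -> M) : Prop :=
  exists n (b : 'I_n -> regfun G) (e : 'I_n -> M),
    forall g, F g = \sum_i evalg g (b i) *: e i.

Lemma regular_mapD M (F H : G -> M) :
  regular_map F -> regular_map H -> regular_map (fun g => F g + H g).
Proof.
move=> [n [b [e Fe]]] [n' [b' [e' He]]]; exists (n + n')%N.
exists (fun i => match split i with inl j => b j | inr j => b' j end).
exists (fun i => match split i with inl j => e j | inr j => e' j end) => g.
rewrite Fe He big_split_ord; congr (_ + _); apply: eq_bigr => j _.
  by rewrite -[lshift _ _]/(unsplit (inl _ j)) unsplitK.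
by rewrite -[rshift _ _]/(unsplit (inr _ j)) unsplitK.
Qed.

Lemma regular_map_sum M (I : finType) (F : I -> G -> M) :
  (forall i, regular_map (F i)) -> regular_map (fun g => \sum_i F i g).
Proof.
move=> Freg; elim: (index_enum I) => [|i s IHs].
  exists 0%N, (fun=> 0), (fun=> 0) => g; by rewrite big_nil big_ord0.
have [n [b [e be]]] := regular_mapD (Freg i) IHs.
by exists n, b, e => g; rewrite big_cons be.
Qed.

Lemma regular_mapZ M (a : regfun G) (F : G -> M) :
  regular_map F -> regular_map (fun g => evalg g a *: F g).
Proof.
move=> [n [b [e Fe]]]; exists n, (fun i => a * b i), e => g.
by rewrite Fe scaler_sumr; apply: eq_bigr => i _; rewrite scalerA evalgM.
Qed.

Lemma regular_map_comp M N (L : M -> N) (F : G -> M) :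
  linear L -> regular_map F -> regular_map (fun g => L (F g)).
Proof.
move=> LL [n [b [e Fe]]]; exists n, b, (fun i => L (e i)) => g.
by rewrite Fe (linear_combination LL).
Qed.

End RegularMaps.

(** * From reductivity of K to reductivity of the two actions *)

Lemma restrict_rational (k : closedFieldType) (K G : affine_group k)
    (i : closed_inclusion K G) (M : lmodType k) (act : G -> M -> M) :
  rational_action act -> rational_action (fun x : K => act (i x)).
Proof.
move=> actP; apply: coaction_rational.
- by move=> m; rewrite incl1 (act1 actP).
- by move=> g h m; rewrite inclM (actM actP).
- by move=> g; apply: act_linear.
move=> m; have [n [b [e be]]] :=
  rational_coaction (act_linear actP) (act_rational actP) m.
exists n, (fun j => projT1 (cid (incl_restr i (b j)))), e => g; rewrite be.
by apply: eq_bigr => j _; case: cid => h /= ->.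
Qed.

(** The class 1 + J is fixed, since algebra automorphisms fix 1, so reductivity of K lifts it. *)
Lemma linearly_reductive_action_of_group (k : closedFieldType)
    (K : affine_group k) (R : rat_algebra K) :
  linearly_reductive K -> linearly_reductive_action R.
Proof.
move=> Kred M J f [fL _ fA] fsurj.
apply: (Kred (RatModule (gr_actP M)) (RatModule (gr_actP (quot_module J))) f) => //.
by move=> x; rewrite /= quot_actE ra_act_one.
Qed.

Lemma linearly_reductive_homogeneous (k : closedFieldType)
    (K G : affine_group k) (i : closed_inclusion K G) :
  linearly_reductive K -> linearly_reductive_action (homogeneous_algebra i).
Proof.
move=> Kred M J f [fL fR fA] fsurj.
have MP := gr_actP M.
have [m0 m0K fm0] : exists2 m0 : M,
    (forall x, gr_act (i x) m0 = m0) & f m0 = qpi J 1.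
  apply: (Kred (RatModule (restrict_rational i MP))
    (RatModule (restrict_rational i (gr_actP (quot_module J)))) f fL
    (fun x m => fA (i x) m) fsurj (qpi J 1)).
  by move=> x; rewrite /= quot_actE ra_act_one.
have [n [p [A [pfree pA]]]] :=
  coaction_orbit (rational_coaction (act_linear MP) (act_rational MP) m0).
have coef := free_coef pfree.
have fp g : f (gr_act g m0) = qpi J 1.
  by rewrite fA fm0 /= quot_actE ra_act_one.
(* Compare coordinates in (y x).m0 = y.m0, for x in K. *)
have Ainv j : A j \in Defs.invariant i.
  apply/invariantP => x; apply: evalg_inj => y; rewrite rtranslE.
  apply: (coef (fun j => evalg (y * i x)%g (A j)) (fun j => evalg y (A j))).
  by rewrite -!pA (actM MP) m0K.
pose a j : homogeneous_algebra i := InvFun (Ainv j).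
(* If 1 + J vanishes, the zero vector lifts it; otherwise it can be cancelled from scalar
   identities. *)
have [J1|J1] := eqVneq (qpi J 1) 0.
  exists 0; rewrite ?(linear_map0 fL) // => g.
  by rewrite (linear_map0 (act_linear MP g)).
exists (\sum_j gr_scale (a j) (gr_act (p j) m0)); last first.
  have -> : f (\sum_j gr_scale (a j) (gr_act (p j) m0))
          = \sum_j gr_scale (a j) (qpi J 1 : quot_module J).
    by rewrite (linear_map_sum fL); apply: eq_bigr => j _; rewrite fR fp.
  under eq_bigr do rewrite /= quot_scaleE mulr1.
  rewrite -qpi_sum; congr qpi; apply/val_inj/evalg_inj => x.
  have -> : val (\sum_j a j : invfun i) = \sum_j 1 *: A j.
    rewrite -[RHS](invfun_sum (fun=> 1) a); congr inv_val.
    by apply: eq_bigr => j _; rewrite scale1r.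
  rewrite evalg_sum [RHS]evalg1; under eq_bigr do rewrite mul1r.
  (* Applying [f] to x.m0 = sum_j A_j(x) e_j gives sum_j A_j(x) = 1 for each x. *)
  have E : (\sum_j evalg x (A j)) *: (qpi J 1 : quot_module J) = qpi J 1.
    rewrite -[RHS](fp x) pA (linear_combination fL) scaler_suml.
    by apply: eq_bigr => j _; rewrite fp.
  have /eqP : (\sum_j evalg x (A j) - 1) *: (qpi J 1 : quot_module J) = 0.
    by rewrite scalerBl E scale1r subrr.
  by rewrite scaler_eq0 (negPf J1) orbF subr_eq0 => /eqP.
move=> h.
have scaleZ (c : k) (r : homogeneous_algebra i) (m : M) :
    gr_scale r (c *: m) = gr_scale (c *: r) m.
  rewrite (linear_mapZ (gr_scale_linearr (g := M) r)).
  by rewrite (linear_mapZ (gr_scale_linearl (g := M) m)).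
have step j : gr_act h (gr_scale (a j) (gr_act (p j) m0)) =
    \sum_l gr_scale (evalg (h * p j)%g (A l) *: ra_act h (a j)) (gr_act (p l) m0).
  rewrite gr_act_scale -(actM MP) pA.
  rewrite (linear_combination (gr_scale_linearr (g := M) _)).
  apply: eq_bigr => l _; rewrite -scaleZ.
  by rewrite (linear_mapZ (gr_scale_linearr (g := M) _)).
rewrite (linear_map_sum (act_linear MP h)).
under eq_bigr do rewrite step.
rewrite exchange_big /=; apply: eq_bigr => l _.
rewrite -(linear_map_sum (gr_scale_linearl (g := M) (gr_act (p l) m0))).
congr (gr_scale _ _); apply/val_inj/evalg_inj => x.
rewrite [val _]invfun_sum evalg_sum.
(* Expanding x.m0 = h.((h^-1 x).m0) in the free family gives A_l(x) = sum_j A_j(h^-1 x) A_l(h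
   p_j). *)
rewrite -[RHS](coef
  (fun l => \sum_j evalg (h^-1 * x)%g (A j) * evalg (h * p j)%g (A l))
  (fun l => evalg x (A l))).
  by apply: eq_bigr => j _; rewrite /= ltranslE mulrC.
have -> : x = (h * (h^-1 * x))%g by rewrite mulgA mulgV mul1g.
rewrite -pA [RHS](actM MP) [in RHS]pA mulgA mulVg mul1g.
rewrite (linear_combination (act_linear MP h)).
under [RHS]eq_bigr do rewrite -(actM MP) pA scaler_sumr.
rewrite exchange_big; apply: eq_bigr => j _; rewrite scaler_suml.
by apply: eq_bigr => l' _; rewrite scalerA.
Qed.

(** * The K-module k[G] (x) W and the induced module of its K-fixed vectors *)

Section InducedModule.

Variables (k : closedFieldType) (K G : affine_group k) (i : closed_inclusion K G).
(* B is the matrix of an n-dimensional K-module W, on which [Bsum] makes the sum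
   of the coordinates a K-invariant linear form. *)
Variables (n : nat) (B : 'I_n -> 'I_n -> regfun K).
Hypothesis B1 : forall r s, evalg 1%g (B r s) = (r == s)%:R.
Hypothesis BM : forall x y r s,
  evalg (x * y)%g (B r s) = \sum_t evalg x (B r t) * evalg y (B t s).
Hypothesis Bsum : forall x s, \sum_r evalg x (B r s) = 1.

(* k[G] (x) W, with k[G] acting on the first factor and K acting diagonally *)
Definition tensor_car : lmodType k := {ffun 'I_n -> regfun G}.

Definition tensor_act (x : K) (v : tensor_car) : tensor_car :=
  [ffun r => \sum_s evalg x (B r s) *: rtransl_incl i x (v s)].

Definition tensor_scale (f : regfun G) (v : tensor_car) : tensor_car :=
  [ffun r => f * v r].

(** The identity of k[G] tensored with the invariant linear form on W. *)
Definition tensor_sum (v : tensor_car) : regfun G := \sum_r v r.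

Lemma tensor_actE x v r y :
  evalg y (tensor_act x v r) = \sum_s evalg x (B r s) * evalg (y * i x)%g (v s).
Proof.
by rewrite ffunE evalg_sum; apply: eq_bigr => s _; rewrite rtranslE.
Qed.

Lemma tensor_ext (v w : tensor_car) :
  (forall r y, evalg y (v r) = evalg y (w r)) -> v = w.
Proof. by move=> vw; apply/ffunP => r; apply: evalg_inj. Qed.

Lemma tensor_act_linear x : linear (tensor_act x).
Proof.
move=> c v w; apply: tensor_ext => r y.
rewrite tensor_actE !ffunE evalg_linear !evalg_sum mulr_sumr -big_split.
apply: eq_bigr => s _ /=.
by rewrite !rtranslE !ffunE evalg_linear mulrDr mulrCA.
Qed.

Lemma tensor_act1 v : tensor_act 1%g v = v.
Proof.
apply: tensor_ext => r y; rewrite tensor_actE (bigD1 r) //= B1 eqxx mul1r.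
rewrite big1 ?addr0 ?incl1 ?mulg1 // => s sr.
by rewrite B1 eq_sym (negPf sr) mul0r.
Qed.

Lemma tensor_actM x y v : tensor_act (x * y)%g v = tensor_act x (tensor_act y v).
Proof.
apply: tensor_ext => r z; rewrite !tensor_actE.
under [RHS]eq_bigr do rewrite tensor_actE mulr_sumr.
rewrite exchange_big; apply: eq_bigr => s _; rewrite BM mulr_suml.
by apply: eq_bigr => t _; rewrite inclM !mulgA mulrA.
Qed.

(** The elementary tensor of f with the r-th basis vector of W. *)
Definition tensor_single (r : 'I_n) (f : regfun G) : tensor_car :=
  [ffun s => if s == r then f else 0].

Lemma tensor_single_linear r : linear (tensor_single r).
Proof.
move=> c f h; apply/ffunP => s; rewrite !ffunE.
by case: eqP => // _; rewrite scaler0 addr0.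
Qed.

Lemma tensor_sum_single (v : tensor_car) : v = \sum_r tensor_single r (v r).
Proof.
apply/ffunP => s; rewrite sum_ffunE (bigD1 s) //= ffunE eqxx.
by rewrite big1 ?addr0 // => r rs; rewrite ffunE eq_sym (negPf rs).
Qed.

Lemma tensor_act_rational : rational_action tensor_act.
Proof.
apply: coaction_rational tensor_act1 tensor_actM tensor_act_linear _ => v.
have rP := rtransl_rational i.
have [N [b [e be]]] : regular_map (fun x => \sum_r \sum_s
    evalg x (B r s) *: tensor_single r (rtransl_incl i x (v s))).
  apply: regular_map_sum => r; apply: regular_map_sum => s.
  apply: regular_mapZ; apply: regular_map_comp (tensor_single_linear r) _.
  exact: rational_coaction (act_linear rP) (act_rational rP) (v s).
exists N, b, e => x; rewrite -be [LHS]tensor_sum_single.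
apply: eq_bigr => r _; rewrite ffunE.
by rewrite (linear_combination (tensor_single_linear r)).
Qed.

Lemma tensor_scale_linearl v : linear (tensor_scale ^~ v).
Proof. by move=> c f h; apply/ffunP => r; rewrite !ffunE mulrDl scalerAl. Qed.

Lemma tensor_scale_linearr f : linear (tensor_scale f).
Proof. by move=> c v w; apply/ffunP => r; rewrite !ffunE mulrDr scalerAr. Qed.

Lemma tensor_scale1 v : tensor_scale 1 v = v.
Proof. by apply/ffunP => r; rewrite ffunE mul1r. Qed.

Lemma tensor_scaleM f h v :
  tensor_scale (f * h) v = tensor_scale f (tensor_scale h v).
Proof. by apply/ffunP => r; rewrite !ffunE mulrA. Qed.

Lemma tensor_act_scale x f v :
  tensor_act x (tensor_scale f v) =
    tensor_scale (rtransl_incl i x f) (tensor_act x v).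
Proof.
apply/ffunP => r; rewrite !ffunE mulr_sumr; apply: eq_bigr => s _.
by rewrite ffunE rtransl_inclM scalerAr.
Qed.

Definition tensor_module : gr_module (right_translation_algebra i) :=
  @GRModule _ _ (right_translation_algebra i) tensor_car tensor_act tensor_scale
    tensor_act_rational tensor_scale_linearl tensor_scale_linearr
    tensor_scale1 tensor_scaleM tensor_act_scale.

Lemma tensor_sum_linear : linear tensor_sum.
Proof.
move=> c v w; rewrite /tensor_sum scaler_sumr -big_split.
by apply: eq_bigr => r _; rewrite !ffunE.
Qed.

Lemma tensor_sum_scale f v : tensor_sum (tensor_scale f v) = f * tensor_sum v.
Proof.
by rewrite /tensor_sum mulr_sumr; apply: eq_bigr => r _; rewrite ffunE.
Qed.

(** The columns of [B] sum to 1, so only the right translation on the first factor survives. *)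
Lemma tensor_sum_act x v :
  tensor_sum (tensor_act x v) = rtransl_incl i x (tensor_sum v).
Proof.
rewrite /tensor_sum (linear_map_sum (act_linear (rtransl_rational i) x)).
under eq_bigr do rewrite ffunE.
rewrite exchange_big; apply: eq_bigr => s _.
by rewrite -scaler_suml Bsum scale1r.
Qed.

Definition induced_pred : {pred tensor_car} :=
  fun v => `[< fixed tensor_act v >].

Lemma induced_predP v : reflect (fixed tensor_act v) (v \in induced_pred).
Proof. exact: asboolP. Qed.

Lemma induced_submod : GRing.subsemimod_closed induced_pred.
Proof.
split=> [|c v /induced_predP v_inv].
  split=> [|v w /induced_predP v_inv /induced_predP w_inv].
    by apply/induced_predP => x; apply/linear_map0/tensor_act_linear.
  apply/induced_predP => x; have := tensor_act_linear x 1 v w.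
  by rewrite !scale1r v_inv w_inv.
apply/induced_predP => x.
by rewrite (linear_mapZ (tensor_act_linear x)) v_inv.
Qed.
HB.instance Definition _ :=
  GRing.isSubSemiModClosed.Build k tensor_car induced_pred induced_submod.

(* (k[G] (x) W)^K *)
Record induced := Induced { ind_val :> tensor_car; _ : ind_val \in induced_pred }.
HB.instance Definition _ := [isSub for ind_val].
HB.instance Definition _ := [Choice of induced by <:].
HB.instance Definition _ := [SubChoice_isSubLmodule of induced by <:].

Lemma induced_sum N (c : 'I_N -> k) (v : 'I_N -> induced) :
  ind_val (\sum_j c j *: v j) = \sum_j c j *: ind_val (v j).
Proof.
rewrite -[ind_val _]/(val _) raddf_sum.
by apply: eq_bigr => j _; rewrite -[LHS]/(val _) linearZ.
Qed.

Definition left_act (g : G) (v : tensor_car) : tensor_car :=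
  [ffun r => ltransl g (v r)].

Lemma left_act_linear g : linear (left_act g).
Proof. by move=> c v w; apply/ffunP => r; rewrite !ffunE ltransl_linear. Qed.

Lemma left_act_coaction v : regular_map (left_act^~ v).
Proof.
have [N [b [e be]]] :
    regular_map (fun g => \sum_r tensor_single r (ltransl g (v r))).
  apply: regular_map_sum => r; apply: regular_map_comp (tensor_single_linear r) _.
  exact: ltransl_coaction.
exists N, b, e => g; rewrite -be [LHS]tensor_sum_single.
by apply: eq_bigr => r _; rewrite ffunE.
Qed.

(** Left translations on the first factor commute with the diagonal action of K. *)
Lemma left_act_induced g (v : induced) : left_act g v \in induced_pred.
Proof.
case: v => v /= /induced_predP v_inv; apply/induced_predP => x.
apply: tensor_ext => r y; rewrite tensor_actE ffunE ltranslE.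
rewrite -[in RHS](v_inv x) tensor_actE.
by apply: eq_bigr => s _; rewrite ffunE ltranslE mulgA.
Qed.

Lemma tensor_scale_induced (f : invfun i) (v : induced) :
  tensor_scale f v \in induced_pred.
Proof.
case: v f => v /= /induced_predP v_inv [f /= /invariantP f_inv].
by apply/induced_predP => x; rewrite tensor_act_scale v_inv f_inv.
Qed.

Definition induced_act g (v : induced) : induced := Induced (left_act_induced g v).

Definition induced_scale (f : invfun i) (v : induced) : induced :=
  Induced (tensor_scale_induced f v).

Lemma induced_act_rational : rational_action induced_act.
Proof.
apply: coaction_rational.
- by move=> v; apply/val_inj/ffunP => r; rewrite ffunE ltransl1.
- by move=> g h v; apply/val_inj/ffunP => r; rewrite !ffunE ltranslM.
- by move=> g c v w; apply/val_inj; exact: left_act_linear.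
(* The vectors of the expansion must be K-fixed too; [coaction_orbit] takes them in the orbit of v,
   where they are. *)
move=> v; have [N [p [A [_ pA]]]] := coaction_orbit (left_act_coaction v).
exists N, A, (fun j => induced_act (p j) v) => g; apply: val_inj.
by rewrite [RHS]induced_sum -pA.
Qed.

Lemma induced_scale_linearl v : linear (induced_scale ^~ v).
Proof. by move=> c f h; apply/val_inj; exact: tensor_scale_linearl. Qed.

Lemma induced_scale_linearr f : linear (induced_scale f).
Proof. by move=> c v w; apply/val_inj; exact: tensor_scale_linearr. Qed.

Lemma induced_scale1 v : induced_scale 1 v = v.
Proof. by apply/val_inj; exact: tensor_scale1. Qed.

Lemma induced_scaleM f h v :
  induced_scale (f * h) v = induced_scale f (induced_scale h v).
Proof. by apply/val_inj; exact: tensor_scaleM. Qed.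

Lemma induced_act_scale g f v :
  induced_act g (induced_scale f v) =
    induced_scale (ltransl_invfun g f) (induced_act g v).
Proof.
apply/val_inj/ffunP => r; rewrite !ffunE; apply: evalg_inj => y.
by rewrite !(evalgM, ltranslE).
Qed.

Definition induced_module : gr_module (homogeneous_algebra i) :=
  @GRModule _ _ (homogeneous_algebra i) induced induced_act induced_scale
    induced_act_rational induced_scale_linearl induced_scale_linearr
    induced_scale1 induced_scaleM induced_act_scale.

Lemma tensor_sum_induced (v : induced) : tensor_sum v \in Defs.invariant i.
Proof.
case: v => v /= /induced_predP v_inv; apply/invariantP => x.
by rewrite -tensor_sum_act v_inv.
Qed.

Definition induced_to_inv (v : induced) : invfun i := InvFun (tensor_sum_induced v).

Lemma induced_to_inv_linear : linear induced_to_inv.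
Proof. by move=> c v w; apply/val_inj; exact: tensor_sum_linear. Qed.

Lemma induced_to_inv_scale f v :
  induced_to_inv (induced_scale f v) = f * induced_to_inv v.
Proof. by apply/val_inj; exact: tensor_sum_scale. Qed.

Lemma induced_to_inv_act g v :
  induced_to_inv (induced_act g v) = ltransl_invfun g (induced_to_inv v).
Proof.
apply/val_inj; rewrite /= /tensor_sum (linear_map_sum (@ltransl_linear _ _ g)).
by apply: eq_bigr => r _; rewrite ffunE.
Qed.

End InducedModule.

(** * Linearly reductive actions tested on the zero ideal *)

Section ZeroIdeal.

Variables (k : closedFieldType) (G : affine_group k) (R : rat_algebra G).

Definition zero_pred : {pred R} := fun r => r == 0.

Lemma zero_zmod_closed : zmod_closed zero_pred.
Proof. by split=> [|r s /eqP-> /eqP->]; rewrite unfold_in /zero_pred ?subrr. Qed.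
HB.instance Definition _ := GRing.isZmodClosed.Build R zero_pred zero_zmod_closed.

Lemma zero_ideal_mul (r a : R) : a \in zero_pred -> r * a \in zero_pred.
Proof. by rewrite !unfold_in => /eqP->; rewrite mulr0. Qed.

Lemma zero_ideal_act (x : G) (a : R) :
  a \in zero_pred -> ra_act x a \in zero_pred.
Proof.
by rewrite !unfold_in => /eqP->; rewrite (linear_map0 (act_linear (ra_actP R) x)).
Qed.

Definition zero_ideal : stable_ideal R := StableIdeal zero_ideal_mul zero_ideal_act.

(** Identifies R/0 with R. One preimage m1 of 1 is enough for surjectivity, because r = f(r m1). *)
Lemma linearly_reductive_action_zero (M : gr_module R) (f : M -> R) :
  linearly_reductive_action R -> linear f ->
  (forall r m, f (gr_scale r m) = r * f m) ->
  (forall x m, f (gr_act x m) = ra_act x (f m)) ->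
  (exists m, f m = 1) ->
  exists2 m, fixed (@gr_act _ _ _ M) m & f m = 1.
Proof.
move=> Rred fL fR fA [m1 fm1].
have [||m mfix fm] := Rred M zero_ideal (fun m => qpi zero_ideal (f m)).
- split=> [c m m'|r m|x m]; first by rewrite fL qpiD qpiZ.
    by rewrite /= quot_scaleE fR.
  by rewrite /= quot_actE fA.
- elim/qpi_ind => r; exists (gr_scale r m1); by rewrite fR fm1 mulr1.
by exists m => //; have /qpi_eq := fm; rewrite unfold_in subr_eq0 => /eqP.
Qed.

End ZeroIdeal.

(** * The equivalence, with descent to K through the induced module *)

Theorem theorem3p5 (k : closedFieldType) (K G : affine_group k)
    (i : closed_inclusion K G) :
  (linearly_reductive_action (right_translation_algebra i) /\
   linearly_reductive_action (homogeneous_algebra i)) <->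
  linearly_reductive K.
Proof.
split; last first.
  move=> Kred; split; first exact: linearly_reductive_action_of_group.
  exact: linearly_reductive_homogeneous.
case=> Gred GKred M N f fL fA fsurj n nK.
have [n0|n0] := eqVneq n 0.
  have LK x := linear_map0 (act_linear (rm_actP M) x).
  by exists 0; rewrite ?n0 ?(linear_map0 fL).
have [m0 fm0] := fsurj n; have MP := rm_actP M.
have [N0 [p [A [pfree pA]]]] :=
  coaction_orbit (rational_coaction (act_linear MP) (act_rational MP) m0).
(* A basis of W taken in the orbit of m0, so that every basis vector maps to n. *)
pose e r := rm_act (p r) m0.
have coef := free_coef pfree.
(* Since x.e_s = (x p_s).m0, the matrix entries of x are A_r(x p_s). *)
pose B r s := rtransl (p s) (A r).
have eB x s : rm_act x (e s) = \sum_r evalg x (B r s) *: e r.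
  by rewrite /e -(actM MP) pA; apply: eq_bigr => r _; rewrite rtranslE.
have fe r : f (e r) = n by rewrite fA fm0 nK.
have nZ (c d : k) : c *: n = d *: n -> c = d.
  move=> cd; apply/eqP; rewrite -subr_eq0; have /eqP : (c - d) *: n = 0.
    by rewrite scalerBl cd subrr.
  by rewrite scaler_eq0 (negPf n0) orbF.
have B1 r s : evalg 1%g (B r s) = (r == s)%:R.
  apply: (coef (fun r => evalg 1%g (B r s)) (fun r => (r == s)%:R)).
  rewrite -eB (act1 MP) (bigD1 s) //= eqxx scale1r big1 ?addr0 // => t ts.
  by rewrite (negPf ts) scale0r.
have BM x y r s :
    evalg (x * y)%g (B r s) = \sum_t evalg x (B r t) * evalg y (B t s).
  apply: (coef (fun r => evalg (x * y)%g (B r s))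
               (fun r => \sum_t evalg x (B r t) * evalg y (B t s))).
  rewrite -eB (actM MP) eB (linear_combination (act_linear MP x)).
  under eq_bigr do rewrite eB scaler_sumr.
  rewrite exchange_big; apply: eq_bigr => t _; rewrite scaler_suml.
  by apply: eq_bigr => u _; rewrite scalerA mulrC.
(* Apply [f] to x.e_s = sum_r B_rs(x) e_r and cancel n. *)
have Bsum x s : \sum_r evalg x (B r s) = 1.
  apply: nZ; rewrite scale1r -[RHS](nK x) -[in RHS](fe s) -fA eB.
  rewrite (linear_combination fL) scaler_suml.
  by apply: eq_bigr => r _; rewrite fe.
have [w1 w1E] : exists w : tensor_car G N0, tensor_sum w = 1.
  (* The tensor 1 (x) m0: the coordinates of m0 are A_r(1), and they sum to 1 because f(m0) = n. *)
  exists [ffun r => evalg 1%g (A r) *: 1].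
  rewrite /tensor_sum; under eq_bigr do rewrite ffunE.
  rewrite -scaler_suml -[RHS]scale1r; congr (_ *: _); apply: nZ.
  rewrite scale1r scaler_suml -[RHS]fm0 -[in RHS](act1 MP m0) pA.
  by rewrite (linear_combination fL); apply: eq_bigr => r _; rewrite fe.
have [w wfix wE] := linearly_reductive_action_zero (M := tensor_module i B1 BM)
  Gred (@tensor_sum_linear _ G N0) (@tensor_sum_scale _ G N0)
  (tensor_sum_act i Bsum) (ex_intro _ w1 w1E).
have wI : w \in induced_pred i B by apply/induced_predP.
have u1E : induced_to_inv Bsum (Induced wI) = 1 by apply: val_inj.
have [v vfix vE] := linearly_reductive_action_zero (M := induced_module i B)
  GKred (@induced_to_inv_linear _ _ _ i _ B Bsum)
  (induced_to_inv_scale Bsum) (induced_to_inv_act Bsum)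
  (ex_intro _ (Induced wI) u1E).
pose c r := evalg 1%g (ind_val v r).
(* A function fixed by left translations is constant: translating by x moves the point x to 1. *)
have vc r x : evalg x (ind_val v r) = c r.
  have := congr1 (fun u : induced i B => evalg x (ind_val u r)) (vfix x).
  by rewrite /= ffunE ltranslE mulVg.
have csum : \sum_r c r = 1.
  have := congr1 (fun u => evalg 1%g (inv_val u)) vE.
  rewrite /= /tensor_sum evalg1 => <-.
  by rewrite /evalg raddf_sum.
exists (\sum_r c r *: e r); last first.
  rewrite (linear_combination fL); under eq_bigr do rewrite fe.
  by rewrite -scaler_suml csum scale1r.
move=> x; rewrite (linear_combination (act_linear MP x)).
under eq_bigr do rewrite eB scaler_sumr.
rewrite exchange_big; apply: eq_bigr => r _.
(* As the coordinates of v are constant, its K-invariance evaluated at 1 reads sum_s B_rs(x) c_s =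
   c_r. *)
have /induced_predP vK := valP v.
have := congr1 (fun u : tensor_car G N0 => evalg 1%g (u r)) (vK x).
rewrite tensor_actE vc => <-; rewrite scaler_suml.
by apply: eq_bigr => s _; rewrite vc scalerA mulrC.
Qed.
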